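(* For every integer $k>1$, the constant $k/4$ in the inequality $$\left|\sum_{j=1}^k A_j\right|\le \frac{k}{4}I+\sum_{j=1}^k|A_j|\qquad (A_1,\dots,A_k\in\mathbb M_n(\mathbb C)\text{ contractions},\ n\ge 1)$$ is optimal, and partial symmetries in $\mathbb M_3(\mathbb C)$ suffice to attain it. That is: for every integer $k>1$ there exist partial symmetries $A_1,\dots,A_k\in\mathbb M_3(\mathbb C)$ such that, for every real number $c$, if $$\left|\sum_{j=1}^k A_j\right|\le cI_3+\sum_{j=1}^k|A_j|,$$ then $c\ge k/4$.
   Context: $\mathbb M_n(\mathbb C)$ is the algebra of complex $n\times n$ matrices; $|X|=(X^*X)^{1/2}$; a contraction is a matrix with operator norm at most $1$; $I$ (or $I_n$) is the identity matrix. For Hermitian $S,T$ of the same size, $S\le T$ means $T-S$ is positive semidefinite. A partial symmetry is a Hermitian matrix whose spectrum is contained in $\{-1,0,1\}$ (in particular it is a contraction). The displayed inequality with constant $k/4$ is a known theorem of Bourin and Lee, valid for all $n$ and all contractions; ''optimal'' means that $k/4$ cannot be replaced by a smaller constant. *)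

(* Defs.v *)
From mathcomp Require Import all_boot all_order all_algebra.
From mathcomp Require Export reals.
From mathcomp Require Export complex.

Set Implicit Arguments.
Unset Strict Implicit.
Unset Printing Implicit Defensive.

Import Order.TTheory GRing.Theory Num.Theory.
Local Open Scope ring_scope.
Local Open Scope sesquilinear_scope.

Section MatrixAbs.
Variables (C : numClosedFieldType) (n : nat).
Implicit Types A B S T : 'M[C]_n.

Definition psdmx A : Prop :=
  A \is hermsymmx /\ forall x : 'cV[C]_n, 0 <= (x ^t* *m A *m x) 0 0.

Definition lemx S T : Prop := psdmx (T - S).

(* Spectral functional calculus: only meaningful for positive semidefinite A,
   where it is the unique positive semidefinite square root (see absmx_unique
   below). *)
Definition sqrtmx A : 'M[C]_n :=
  invmx (spectralmx A) *m diag_mx (map_mx sqrtC (spectral_diag A))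
    *m spectralmx A.

Definition absmx A : 'M[C]_n := sqrtmx (A ^t* *m A).

(* eigenvalue refers to row eigenvectors; the spectrum is the same. *)
Definition partial_symmetry A : Prop :=
  A \is hermsymmx /\ forall a : C, eigenvalue A a -> a \in [:: -1; 0; 1].

Lemma psdmx_diag A (P := spectralmx A) (d := spectral_diag A) :
  psdmx A -> A = P ^t* *m diag_mx d *m P /\ forall i, 0 <= d 0 i.
Proof.
move=> [hA pA].
have /orthomx_spectralP eA := hermitian_normalmx hA.
have uP : P \is unitarymx by exact: spectral_unitarymx.
have eA' : A = P ^t* *m diag_mx d *m P.
  by rewrite {1}eA invmx_unitary.
split=> // i; have := pA (P ^t* *m delta_mx i 0).
have uP' := unitarymxP uP.
rewrite trmx_mul map_mxM /= trmxCK {1}eA' !mulmxA.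
rewrite -[_ *m P *m P ^t*]mulmxA uP' mulmx1 -[_ *m P *m P ^t*]mulmxA uP' mulmx1.
rewrite trmx_delta map_delta_mx -rowE -colE !mxE eqxx mulr1n.
by [].
Qed.

Lemma psdmx_undiag (P : 'M[C]_n) (d : 'rV[C]_n) : (forall i, 0 <= d 0 i) ->
  psdmx (P ^t* *m diag_mx d *m P).
Proof.
move=> d0; have herm : diag_mx d ^t* = diag_mx d.
  apply/matrixP => i j; rewrite !mxE eq_sym; case: eqVneq => [->|_].
    by rewrite !mulr1n; apply/CrealP; exact: ger0_real.
  by rewrite !mulr0n rmorph0.
split.
  apply/is_hermitianmxP; rewrite expr0 scale1r.
  by rewrite !trmx_mul !map_mxM /= trmxCK herm mulmxA.
move=> x; set y := P *m x.
have -> : x ^t* *m (P ^t* *m diag_mx d *m P) *m x = y ^t* *m (diag_mx d *m y).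
  by rewrite /y trmx_mul map_mxM !mulmxA.
rewrite mxE sumr_ge0 // => i _; rewrite mul_diag_mx !mxE mulrCA.
by rewrite mulr_ge0 // mulrC mul_conjC_ge0.
Qed.

Lemma psdmx_gram A : psdmx (A ^t* *m A).
Proof.
have := @psdmx_undiag A (const_mx 1); rewrite diag_const_mx mulmx1; apply.
by move=> i; rewrite mxE ler01.
Qed.

Lemma sqrtmxP A : psdmx A -> psdmx (sqrtmx A) /\ sqrtmx A *m sqrtmx A = A.
Proof.
move=> pA; have [eA d0] := psdmx_diag pA; rewrite /sqrtmx.
have uP := spectral_unitarymx A.
rewrite invmx_unitary //; split.
  by apply: psdmx_undiag => i; rewrite mxE sqrtC_ge0.
rewrite [RHS]eA !mulmxA.
rewrite -[_ *m spectralmx A *m (spectralmx A) ^t*]mulmxA (unitarymxP uP) mulmx1.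
rewrite -[_ *m diag_mx _ *m diag_mx _]mulmxA mulmx_diag; congr (_ *m diag_mx _ *m _).
by apply/rowP => i; rewrite !mxE -expr2 sqrtCK.
Qed.

Lemma absmxP A : psdmx (absmx A) /\ absmx A *m absmx A = A ^t* *m A.
Proof. exact/sqrtmxP/psdmx_gram. Qed.

Lemma psdmx_sqr_inj A B : psdmx A -> psdmx B -> A *m A = B *m B -> A = B.
Proof.
move=> /psdmx_diag[]; set P := spectralmx A; set d := spectral_diag A => eA d0.
move=> /psdmx_diag[]; set Q := spectralmx B; set e := spectral_diag B => eB e0.
have uP : P *m P ^t* = 1%:M by apply/unitarymxP/spectral_unitarymx.
have uQ : Q *m Q ^t* = 1%:M by apply/unitarymxP/spectral_unitarymx.
have uP' := mulmx1C uP; have uQ' := mulmx1C uQ.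
have PA : P *m A = diag_mx d *m P by rewrite {1}eA !mulmxA uP mul1mx.
have BQ : B *m Q ^t* = Q ^t* *m diag_mx e by rewrite {1}eB -!mulmxA uQ mulmx1.
move=> AB; pose W := P *m Q ^t*.
have DW : diag_mx d *m (diag_mx d *m W) = W *m diag_mx e *m diag_mx e.
  rewrite /W !mulmxA -[diag_mx d *m diag_mx d *m P]mulmxA -PA mulmxA -PA.
  rewrite -[P *m A *m A]mulmxA AB -!mulmxA; congr (_ *m _).
  by rewrite BQ [LHS]mulmxA BQ -!mulmxA.
have : diag_mx d *m W = W *m diag_mx e.
  apply/matrixP => i j; move/matrixP: DW => /(_ i j).
  rewrite !(mul_diag_mx, mul_mx_diag) !mxE.
  have [->|w0] := eqVneq (\sum_k P i k * (Q ^t*) k j) 0; first by rewrite !(mulr0, mul0r).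
  rewrite [LHS]mulrA -[RHS]mulrA [LHS]mulrC -!expr2 => /(mulfI w0)/eqP.
  by rewrite eqrXn2 // => /eqP ->; rewrite mulrC.
rewrite /W mulmxA -PA -mulmxA => /(congr1 (fun X => P ^t* *m X *m Q)).
rewrite -!mulmxA uQ' mulmx1 (mulmxA (P ^t*)) uP' mul1mx.
by rewrite !mulmxA uP' mul1mx -eB.
Qed.

Lemma absmx_unique A B : psdmx B -> B *m B = A ^t* *m A -> B = absmx A.
Proof.
by move=> pB eB; have [pA eA] := absmxP A; apply: psdmx_sqr_inj; rewrite // eA.
Qed.

End MatrixAbs.

(* Main.v *)
(** Suppose a unit vector [x] and [y] orthogonal to it satisfy [S x = (k/2) y]
    and [S y = (k/2) x], where [S] is the sum of the [A_j]: then
    [<x, |S| x> = k/2].  Take for [A_j] the partial isometry exchanging [y] with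
    a unit vector [u_j] orthogonal to [y].  Since [|A_j|] projects onto the span
    of [u_j] and [y], the summand contributes [<x, |A_j| x> = |<x, u_j>|^2], so
    [<x, u_j> = 1/2] gives [k/2 - k/4 = k/4] in total.  In dimension 3 this
    forces [u_j = x/2 + (sqrt 3/2) z_j e] with [e] orthogonal to [x] and [y] and
    [z_j] of modulus 1; the condition on [S] is that the [z_j] sum to zero, as
    the [k]-th roots of unity do. *)

Require Import Defs.
From mathcomp Require Import all_boot all_order all_algebra.
From mathcomp Require Import ring.

Set Implicit Arguments.
Unset Strict Implicit.
Unset Printing Implicit Defensive.

Import Order.TTheory GRing.Theory Num.Theory.
Local Open Scope ring_scope.
Local Open Scope sesquilinear_scope.

Lemma hermsymmxP (C : numClosedFieldType) n (A : 'M[C]_n) :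
  reflect (A ^t* = A) (A \is hermsymmx).
Proof.
by apply: (iffP (is_hermitianmxP _ _ _)); rewrite expr0 scale1r => /esym.
Qed.

(** Every eigenvalue is a root of [X^3 - X], which factors as [(X + 1) X (X - 1)]. *)
Lemma partial_symmetry_cube (C : numClosedFieldType) n (A : 'M[C]_n) :
  A ^t* = A -> A *m A *m A = A -> partial_symmetry A.
Proof.
move=> hA A3; split; first exact/hermsymmxP.
move=> a /eigenvalueP[v vA v0].
have : (a ^+ 3 - a) *: v == 0.
  rewrite scalerBl subr_eq0 -vA -[in v *m A]A3 !mulmxA.
  by rewrite !(vA, =^~ scalemxAl) !scalerA exprS expr2 mulrA.
rewrite scaler_eq0 (negPf v0) orbF.
have -> : a ^+ 3 - a = (a + 1) * a * (a - 1) by ring.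
by rewrite !mulf_eq0 addr_eq0 subr_eq0 !inE orbA.
Qed.

(** Here [A *m A] is the Gram matrix of [A], hence positive semidefinite, and it is idempotent by
    the cubic identity, so it is its own square root. *)
Lemma absmx_cube (C : numClosedFieldType) n (A : 'M[C]_n) :
  A ^t* = A -> A *m A *m A = A -> absmx A = A *m A.
Proof.
move=> hA A3; apply/esym/absmx_unique; rewrite ?mulmxA ?A3 ?hA //.
by rewrite -{1}hA; exact: psdmx_gram.
Qed.

Lemma absmxZ (C : numClosedFieldType) n (a : C) (A : 'M[C]_n) :
  0 <= a -> absmx (a *: A) = a *: absmx A.
Proof.
move=> a0; have [[/hermsymmxP hA pA] eA] := absmxP A.
have ca : a^* = a by apply/CrealP; exact: ger0_real.
apply/esym/absmx_unique.
  split=> [|x]; first by apply/hermsymmxP; rewrite linearZ /= map_mxZ /= ca hA.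
  by rewrite -scalemxAr -scalemxAl mxE mulr_ge0.
by rewrite [(a *: A)^T]linearZ /= map_mxZ /= ca -!scalemxAl -!scalemxAr eA.
Qed.

Definition swapmx (C : numClosedFieldType) n (u v : 'cV[C]_n) : 'M[C]_n :=
  u *m v ^t* + v *m u ^t*.

Lemma swapmx_herm (C : numClosedFieldType) n (u v : 'cV[C]_n) :
  (swapmx u v) ^t* = swapmx u v.
Proof.
by rewrite /swapmx linearD map_mxD /= !trmx_mul !map_mxM /= !trmxCK addrC.
Qed.

Section Orthonormal.
Variables (C : numClosedFieldType) (n : nat) (u v : 'cV[C]_n).
Hypotheses (uu : u ^t* *m u = 1%:M) (vv : v ^t* *m v = 1%:M).
Hypotheses (uv : u ^t* *m v = 0).

Lemma mul_swapmx_l : swapmx u v *m u = v.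
Proof.
have vu : v ^t* *m u = 0.
  by rewrite -[LHS]trmxCK trmx_mul map_mxM /= trmxCK uv trmx0 map_mx0.
by rewrite mulmxDl -!mulmxA vu uu mulmx0 mulmx1 add0r.
Qed.

Lemma mul_swapmx_r : swapmx u v *m v = u.
Proof. by rewrite mulmxDl -!mulmxA uv vv mulmx0 mulmx1 addr0. Qed.

Lemma swapmx_sqr : swapmx u v *m swapmx u v = u *m u ^t* + v *m v ^t*.
Proof.
by rewrite {2}/swapmx mulmxDr !mulmxA mul_swapmx_l mul_swapmx_r addrC.
Qed.

Lemma swapmx_cube : swapmx u v *m swapmx u v *m swapmx u v = swapmx u v.
Proof.
rewrite -mulmxA swapmx_sqr mulmxDr !mulmxA mul_swapmx_l mul_swapmx_r.
by rewrite addrC.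
Qed.

Lemma absmx_swapmx : absmx (swapmx u v) = u *m u ^t* + v *m v ^t*.
Proof. by rewrite absmx_cube ?swapmx_herm ?swapmx_cube ?swapmx_sqr. Qed.

Lemma partial_symmetry_swapmx : partial_symmetry (swapmx u v).
Proof. by apply: partial_symmetry_cube; rewrite ?swapmx_herm ?swapmx_cube. Qed.

End Orthonormal.

(** The [k]-th roots of unity work: up to sign, their sum is the coefficient of degree [k - 1] in
    [X^k - 1]. *)
Lemma unit_sum0 (C : numClosedFieldType) k : (1 < k)%N ->
  exists z : 'I_k -> C, (forall j, `|z j| = 1) /\ \sum_j z j = 0.
Proof.
case: k => [|[|k]] // _.
have [rs] := closed_field_poly_normal ('X^(k.+2) - 1%:P : {poly C}).
rewrite lead_coefXnsubC // scale1r => ers.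
have szrs : size rs = k.+2.
  have := size_XnsubC (1 : C) (ltn0Sn k.+1).
  by rewrite ers size_prod_XsubC => -[].
exists (fun j => rs`_j); split=> [j|].
  have : root ('X^(k.+2) - 1%:P) rs`_j by rewrite ers root_prod_XsubC mem_nth ?szrs.
  rewrite rootE !hornerE subr_eq0 => /eqP/(congr1 Num.norm).
  by rewrite normrX normr1 => /eqP; rewrite pexpr_eq1 // => /eqP.
(* After the case split the degree is [k.+2], so the coefficient read here has index [k.+1],
   strictly between 0 and the degree: it vanishes. *)
have := @coefPn_prod_XsubC _ rs; rewrite szrs -ers => /(_ isT) /=.
rewrite coefB coefXn coefC ltn_eqF // subr0 => /esym/eqP.
by rewrite oppr_eq0 (big_nth 0) big_mkord szrs => /eqP.
Qed.

Theorem theorem2p2 (R : realType) (k : nat) (hk : (1 < k)%N) :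
  exists A : 'I_k -> 'M[R[i]]_3,
    (forall j : 'I_k, partial_symmetry (A j)) /\
    (forall c : R,
       lemx (absmx (\sum_(j < k) A j))
            ((c%:C)%C%:M + \sum_(j < k) absmx (A j)) ->
       k%:R / 4 <= c).
Proof.
have [z [z1 z0]] := @unit_sum0 R[i] k hk.
pose s : R[i] := sqrtC (3 / 4).
have s2 : `|s| ^+ 2 = 3 / 4.
  by rewrite ger0_norm ?sqrtC_ge0 ?divr_ge0 // sqrtCK.
pose x : 'cV[R[i]]_3 := delta_mx 0 0.
pose y : 'cV[R[i]]_3 := delta_mx 1 0.
pose e : 'cV[R[i]]_3 := delta_mx 2 0.
pose u j := 2^-1 *: x + (s * z j) *: e.
have dotE i j : (delta_mx i 0 : 'cV[R[i]]_3) ^t* *m delta_mx j 0 = (i == j)%:R%:M.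
  rewrite trmx_delta map_delta_mx mul_delta_mx_cond.
  by apply/matrixP => a b; rewrite !ord1; case: (i == j); rewrite !mxE ?mul0rn.
have yy : y ^t* *m y = 1%:M by rewrite dotE.
have xx : x ^t* *m x = 1%:M by rewrite dotE.
have xy : x ^t* *m y = 0 by rewrite dotE raddf0.
have uE j : (u j) ^t* = (2^-1)^* *: x ^t* + (s * z j)^* *: e ^t*.
  by rewrite /u linearD !linearZ /= map_mxD !map_mxZ.
have uy j : (u j) ^t* *m y = 0.
  by rewrite uE mulmxDl -!scalemxAl !dotE /= raddf0 !scaler0 addr0.
have uu j : (u j) ^t* *m u j = 1%:M.
  rewrite uE /u mulmxDl !mulmxDr -!scalemxAl -!scalemxAr !dotE /=.
  rewrite raddf0 !scaler0 addr0 add0r !scale_scalar_mx !mulr1 -raddfD /=.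
  (* The cross terms are gone; the squared norm that remains is [1/4 + 3/4]. *)
  rewrite ![_^* * _]mulrC -!normCK normrM z1 mulr1 s2.
  by congr _%:M; rewrite normfV normr_nat; field.
exists (fun j => swapmx (u j) y); split=> [j|c].
  exact: partial_symmetry_swapmx.
(* [swapmx] is additive in its first argument, so only the sum of the [u j] matters. Its [e]
   component cancels, and the factor [k/2] is real, hence unaffected by the conjugation in the
   second term. *)
have sumA : \sum_(j < k) swapmx (u j) y = (k%:R / 2) *: swapmx x y.
  have sumu : \sum_j u j = (k%:R / 2) *: x.
    rewrite big_split /= sumr_const card_ord -scaler_suml -mulr_sumr z0.
    by rewrite mulr0 scale0r addr0 scalerMnl -mulr_natl.
  rewrite big_split /= -mulmx_suml -mulmx_sumr.
  have -> : \sum_j (u j) ^t* = (\sum_j u j) ^t* by rewrite linear_sum raddf_sum.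
  rewrite sumu [(_ *: x)^T]linearZ /= map_mxZ /= rmorphM fmorphV !rmorph_nat.
  by rewrite -scalemxAl -scalemxAr -scalerDr.
rewrite sumA absmxZ ?divr_ge0 ?ler0n // absmx_swapmx //.
under eq_bigr do rewrite absmx_swapmx //.
case=> _ /(_ x).
(* As [x] is a basis vector, the quadratic form is the entry at [0 0]. There [y] contributes nothing
   and each [u j] contributes [1/2 * 1/2]. *)
rewrite trmx_delta map_delta_mx -rowE -colE !mxE summxE.
under eq_bigr do
  rewrite !mxE !big_ord1 !mxE /= !(mulr0, mul0r, addr0, mulr1) fmorphV rmorph_nat.
rewrite !big_ord1 !mxE /= sumr_const card_ord -[_ *+ k]mulr_natl.
rewrite mulr1n mul0r addr0 !mulr1.
set t := (X in 0 <= X).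
(* The entry is [c + k/4 - k/2]; recognizing it as the image of a real number brings the inequality
   back to [R]. *)
have -> : t = (c - k%:R / 4)%:C%C.
  by rewrite raddfB /= fmorph_div !rmorph_nat /t; field.
by rewrite ler0c subr_ge0.
Qed.
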